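(* Let $\alpha_1,\dots,\alpha_m$ be positive real numbers such that $\log\alpha_1,\dots,\log\alpha_m$ are linearly independent over $\mathbb{Q}$. If $f\in\mathbb{R}(x,\alpha_1^x,\dots,\alpha_m^x)$ is such that the sequence $(f(n))_{n\ge0}$ is holonomic, then $f(x)\in\mathbb{R}(x)[\alpha_1^{x},\alpha_1^{-x},\dots,\alpha_m^{x},\alpha_m^{-x}]$.
   Context: A sequence $(a_n)$ of complex numbers is holonomic if there exist polynomials $p_0,\dots,p_d\in\mathbb{C}[x]$, not all zero, such that $p_0(n)a_n+p_1(n)a_{n+1}+\dots+p_d(n)a_{n+d}=0$ for all sufficiently large integers $n$. *)

(* Defs.v *)
From mathcomp Require Import all_boot all_order all_algebra.
From mathcomp Require Import reals exp complex mpoly.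

Set Implicit Arguments.
Unset Strict Implicit.
Unset Printing Implicit Defensive.

Import Order.TTheory GRing.Theory Num.Theory.
Local Open Scope ring_scope.

Definition holonomic (C : nzRingType) (a : nat -> C) : Prop :=
  exists (d : nat) (p : 'I_d.+1 -> {poly C}),
    (exists i, p i != 0) /\
    exists N : nat, forall n : nat, (N <= n)%N ->
      \sum_(i < d.+1) (p i).[n%:R] * a (n + i)%N = 0.

(* A realType is not finite-dimensional over rat, so free from vector.v does
   not apply. *)
Definition lin_indep_rat (R : realType) (m : nat) (v : 'I_m -> R) : Prop :=
  forall c : 'I_m -> rat,
    \sum_(i < m) ratr (c i) * v i = 0 -> forall i, c i = 0.

(* The function x |-> P(x, alpha_1^x, ..., alpha_m^x): variable 0 of P is
   evaluated at x and variable j + 1 at alpha_j^x. *)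
Definition exp_poly (R : realType) (m : nat) (alpha : 'I_m -> R)
    (P : {mpoly R[m.+1]}) (x : R) : R :=
  P.@[fun i => oapp (fun j => alpha j `^ x) x (unlift ord0 i)].

(* The element
     \sum_(e in s) (p e / q e) * alpha_1^(e_1 x) * ... * alpha_m^(e_m x)
   of R(x)[alpha_1^x, alpha_1^-x, ..., alpha_m^x, alpha_m^-x], as a function;
   it is meant to be used at points where no q e with e in s vanishes. *)
Definition exp_laurent (R : realType) (m : nat) (alpha : 'I_m -> R)
    (s : seq {ffun 'I_m -> int}) (p q : {ffun 'I_m -> int} -> {poly R})
    (x : R) : R :=
  \sum_(e <- s) (p e).[x] / (q e).[x] * \prod_(i < m) (alpha i `^ x) ^ e i.

(* Main.v *)
Require Import Defs.
From mathcomp Require Import all_boot all_order all_algebra.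
From mathcomp Require Import reals sequences exp complex mpoly.
From mathcomp Require Import ring.

Set Implicit Arguments.
Unset Strict Implicit.
Unset Printing Implicit Defensive.

Import Order.TTheory GRing.Theory Num.Theory.
Local Open Scope ring_scope.

(* Let J be the set of exponential polynomials D such that, for all large n,
   D(k) f(k + n) eventually agrees with an element of R(x)[alpha^x].  It is
   stable under D(x) |-> D(x + 1) - c D(x), and the recurrence shows that it
   contains the product of the Q(x + i) with i below its order.  Killing terms
   one after the other with these operators, which is possible because the
   alpha^e are pairwise distinct, leaves a constant times one monomial
   alpha^(e x) in J; hence, for some n, f(x + n) itself is in
   R(x)[alpha^x, alpha^-x].  Applied to the exponential polynomials that vanish
   at all large integers, the same reduction shows that such a function is
   zero, so identities between sequences extend to all real x. *)

(** * Shift operators on families of polynomials *)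

Lemma poly_nat_roots_eq0 (R : numDomainType) (p : {poly R}) (N : nat) :
  (forall n, (N <= n)%N -> p.[n%:R] = 0) -> p = 0.
Proof.
move=> p0; apply/eqP; apply/negPn/negP => pn0.
have := max_poly_roots pn0 (rs := [seq i%:R | i <- iota N (size p)]).
rewrite size_map size_iota ltnn => H; suff: false by [].
apply: H.
  apply/allP => _ /mapP[i + ->]; rewrite mem_iota => /andP[Ni _].
  by apply/rootP/p0.
by rewrite map_inj_uniq ?iota_uniq // => i j /eqP; rewrite eqr_nat => /eqP.
Qed.

(* Applying the operator with c = beta e0, where p e0 != 0, strictly decreases
   the total size of p; when it kills p, only a constant at e0 was left. *)
Lemma shift_stable_const (R : numFieldType) (I : eqType) (s : seq I)
    (beta : I -> R) (N : (I -> {poly R}) -> Prop) :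
  uniq s -> {in s &, injective beta} -> {in s, forall e, beta e != 0} ->
  (forall p c, N p ->
     N (fun e => beta e *: (p e \Po ('X + 1%:P)) - c *: p e)) ->
  forall p, N p -> (exists2 e, e \in s & p e != 0) ->
  exists p' e0 c, [/\ N p', e0 \in s, c != 0, p' e0 = c%:P
    & {in s, forall e, e != e0 -> p' e = 0}].
Proof.
move=> s_uniq beta_inj beta_neq0 Nshift p.
have [k] := ubnP (\sum_(e <- s) size (p e)).
elim: k p => // k IHk p ltk Np [e0 e0s pe0].
pose q e := beta e *: (p e \Po ('X + 1%:P)) - beta e0 *: p e.
have sz1 (r : {poly R}) : size (r \Po ('X + 1%:P)) = size r.
  by rewrite size_comp_poly2 ?size_XaddC.
have lc1 (r : {poly R}) : lead_coef (r \Po ('X + 1%:P)) = lead_coef r.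
  by rewrite lead_coef_comp ?size_XaddC // lead_coefXaddC expr1n mulr1.
have le_q e : (size (q e) <= size (p e))%N.
  rewrite (leq_trans (size_polyD _ _)) // geq_max size_polyN.
  by rewrite !(leq_trans (size_scale_leq _ _)) ?sz1.
have lt_q : (size (q e0) < size (p e0))%N.
  have p_gt0 : (0 < size (p e0))%N by rewrite size_poly_gt0.
  (* The shift preserves leading coefficients, so with the factor [beta e0] the two top terms
     cancel. *)
  rewrite -(prednK p_gt0) ltnS; apply/leq_sizeP => j.
  rewrite leq_eqVlt => /predU1P[<-|ltj].
    rewrite coefB !coefZ -[(p e0)`__]/(lead_coef _) -(sz1 (p e0)).
    by rewrite -[(_ \Po _)`__]/(lead_coef _) lc1 subrr.
  move: ltj; rewrite (prednK p_gt0) => /(leq_trans (le_q e0)).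
  by move=> /leq_sizeP/(_ j (leqnn _)).
have sum_q : (\sum_(e <- s) size (q e) < k)%N.
  rewrite -ltnS (leq_trans _ ltk) // ltnS.
  rewrite !(bigD1_seq e0) //= -addSn leq_add //.
  by apply: leq_sum => e _; apply: le_q.
have [/hasP[e es qe]|/hasPn q0] := boolP (has (fun e => q e != 0) s).
  by apply: (IHk q) => //; [apply: Nshift | exists e].
have {q0}q0 e : e \in s -> q e = 0 by move=> /q0/negPn/eqP.
(* Here [q] vanishes on [s], so [p e0] is invariant under x -> x + 1, hence constant. *)
exists p, e0, (p e0).[0]; have pe0C : p e0 = ((p e0).[0])%:P.
  have shE : p e0 \Po ('X + 1%:P) = p e0.
    apply: (scalerI (beta_neq0 _ e0s)); apply/eqP.
    by rewrite -subr_eq0 -/(q e0) q0.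
  apply/eqP; rewrite -subr_eq0; apply/eqP/(@poly_nat_roots_eq0 _ _ 0) => n _.
  rewrite hornerD hornerN hornerC; apply/eqP; rewrite subr_eq0; apply/eqP.
  elim: n => // n <-; rewrite -[in RHS]shE horner_comp !hornerE.
  by rewrite -natr1.
split=> //; first by apply: contraNneq pe0 => c0; rewrite pe0C c0.
(* Leading coefficients in [q e = 0] give [(beta e - beta e0) * lead_coef (p e) = 0]. *)
move=> e es ne; apply/eqP; rewrite -lead_coef_eq0.
have /eqP := q0 _ es; rewrite subr_eq0 => /eqP/(congr1 lead_coef)/eqP.
rewrite !lead_coefZ lc1 -subr_eq0 -mulrBl mulf_eq0 subr_eq0 => /orP[|//].
by move=> /eqP/beta_inj-/(_ es e0s)/eqP; rewrite (negPf ne).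
Qed.

(** * Exponential monomials *)

Definition exp_monomial (R : realType) (m : nat) (alpha : 'I_m -> R)
    (e : {ffun 'I_m -> int}) (x : R) : R :=
  \prod_(i < m) (alpha i `^ x) ^ e i.

Section ExpMonomial.
Variables (R : realType) (m : nat) (alpha : 'I_m -> R).
Hypothesis alpha_gt0 : forall i, 0 < alpha i.
Local Notation Y := (exp_monomial alpha).

Lemma exp_monomial_gt0 e x : 0 < Y e x.
Proof. by apply: prodr_gt0 => i _; rewrite exprz_gt0 ?powR_gt0. Qed.

Lemma exp_monomialD e x y : Y e (x + y) = Y e x * Y e y.
Proof.
rewrite -big_split; apply: eq_bigr => i _ /=.
rewrite powRD ?(gt_eqF (alpha_gt0 i)) ?implybT //.
by rewrite exprzMl ?unitfE ?gt_eqF ?powR_gt0.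
Qed.

Lemma exp_monomialB e e' x : Y (e - e') x = Y e x / Y e' x.
Proof.
rewrite -prodfV -big_split; apply: eq_bigr => i _ /=.
by rewrite !ffunE expfzDr ?gt_eqF ?powR_gt0 // invr_expz.
Qed.

Lemma exp_monomialE e x :
  Y e x = expR (x * \sum_(i < m) (e i)%:~R * ln (alpha i)).
Proof.
rewrite mulr_sumr expR_sum; apply: eq_bigr => i _.
rewrite /powR gt_eqF //.
have expRz (z : int) (t : R) : expR t ^ z = expR (z%:~R * t).
  case: z => n; first by rewrite expRM_natl.
  rewrite -[LHS]/((expR t ^+ n.+1)^-1).
  by rewrite NegzE mulrNz mulNr expRN -expRM_natl.
by rewrite expRz mulrCA.
Qed.

(** The logarithm of [Y e 1], the multiplier of [Y e] under x -> x + 1, is an integer combination of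
    the [ln (alpha i)]. Linear independence enters only here. *)
Lemma exp_monomial1_inj :
  lin_indep_rat (fun i => ln (alpha i)) -> injective (Y^~ 1).
Proof.
move=> indep e e'; rewrite /= !exp_monomialE !mul1r => /expR_inj eqs.
apply/ffunP => i; apply/eqP; rewrite -(inj_eq (@intr_inj rat)) -subr_eq0.
apply/eqP; move: i; apply: indep.
under eq_bigr => i _ do rewrite rmorphB /= !ratr_int mulrBl.
by rewrite sumrB eqs subrr.
Qed.

End ExpMonomial.

(** * Exponential polynomials and their vanishing at large integers *)

Section ExpPolynomials.
Variables (R : realType) (m : nat) (alpha : 'I_m -> R).
Hypothesis alpha_gt0 : forall i, 0 < alpha i.
Hypothesis ln_alpha_indep : lin_indep_rat (fun i => ln (alpha i)).
Local Notation Y := (exp_monomial alpha).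
Implicit Types (P Q : {mpoly R[m.+1]}) (s : seq {ffun 'I_m -> int}).

Definition exp_exponent (mon : 'X_{1..m.+1}) : {ffun 'I_m -> int} :=
  [ffun i => (mon (lift ord0 i))%:Z].

(** The coefficient of alpha^(e x) when [P] is read as a polynomial in the alpha_j^x over R[x].
    Integer exponents allow a later translation to Laurent exponents. *)
Definition exp_coef P (e : {ffun 'I_m -> int}) : {poly R} :=
  \sum_(mon <- msupp P | exp_exponent mon == e) P@_mon *: 'X^(mon ord0).

Definition exp_sum s (p : {ffun 'I_m -> int} -> {poly R}) (x : R) : R :=
  \sum_(e <- s) (p e).[x] * Y e x.

Lemma exp_poly_mon (mon : 'X_{1..m.+1}) (x : R) :
  exp_poly alpha 'X_[mon] x = x ^+ mon ord0 * Y (exp_exponent mon) x.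
Proof.
rewrite /exp_poly mevalX big_ord_recl unlift_none /=; congr (_ * _).
by apply: eq_bigr => i _; rewrite liftK ffunE /= exprnP.
Qed.

Lemma exp_polyE P s x : uniq s ->
  {in msupp P, forall mon, exp_exponent mon \in s} ->
  exp_poly alpha P x = exp_sum s (exp_coef P) x.
Proof.
move=> s_uniq sP; rewrite /exp_sum /exp_coef.
under eq_bigr => e _ do rewrite horner_sum mulr_suml.
rewrite (exchange_big_dep predT) //= {1}[P]mpolyE.
rewrite /exp_poly rmorph_sum; apply: eq_big_seq => mon monP /=.
rewrite mevalZ -/(exp_poly alpha 'X_[mon] x) exp_poly_mon.
rewrite -big_filter (eq_filter (a2 := pred1 (exp_exponent mon))) => [|e].
  by rewrite filter_pred1_uniq ?sP // big_seq1 hornerZ hornerXn mulrA.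
by rewrite /= eq_sym.
Qed.

(** No cancellation occurs in [exp_coef]: distinct monomials with the same exponential exponent
    differ in their degree in x. *)
Lemma exp_coef_neq0 P : P != 0 -> exists2 mon, mon \in msupp P &
  exp_coef P (exp_exponent mon) != 0.
Proof.
rewrite -msupp_eq0; case E: (msupp P) => [//|mon l] _.
have monP : mon \in msupp P by rewrite E mem_head.
exists mon; first by rewrite -E.
move: (monP); rewrite mcoeff_msupp; apply: contraNneq.
move=> /(congr1 (fun p : {poly R} => p`_(mon ord0))).
rewrite coef0 coef_sum big_mkcond (bigD1_seq mon) ?msupp_uniq //=.
rewrite eqxx coefZ coefXn eqxx mulr1 big1 ?addr0 => [->//|mon' ne].
case: eqP => // eqe; rewrite coefZ coefXn.
case: eqP => [eq0|]; last by rewrite mulr0.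
case/eqP: ne; apply/mnmP => i.
have [j ->|->//] := unliftP ord0 i.
by move/ffunP: eqe => /(_ j); rewrite !ffunE => -[].
Qed.

Lemma exp_polyM P Q x :
  exp_poly alpha (P * Q) x = exp_poly alpha P x * exp_poly alpha Q x.
Proof. exact: mevalM. Qed.

Lemma exp_polyB P Q x :
  exp_poly alpha (P - Q) x = exp_poly alpha P x - exp_poly alpha Q x.
Proof. exact: mevalB. Qed.

Lemma exp_polyD P Q x :
  exp_poly alpha (P + Q) x = exp_poly alpha P x + exp_poly alpha Q x.
Proof. exact: mevalD. Qed.

Definition exp_shift (t : R) P : {mpoly R[m.+1]} :=
  P \mPo [tuple if unlift ord0 i is Some j then (alpha j `^ t) *: 'X_i
          else 'X_i + t%:MP | i < m.+1].

Lemma exp_poly_shift t P x :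
  exp_poly alpha (exp_shift t P) x = exp_poly alpha P (x + t).
Proof.
rewrite /exp_poly comp_mpoly_meval; apply: meval_eq => i; rewrite tnth_mktuple.
case: unliftP => [j ->|->] /=.
  rewrite mevalZ mevalXU liftK /= powRD; first exact: mulrC.
  by rewrite (gt_eqF (alpha_gt0 j)) implybT.
by rewrite mevalD mevalXU mevalC unlift_none.
Qed.

Lemma exp_poly_prod_shift (I : Type) (l : seq I) (S : pred I) (t : I -> R) Q x :
  exp_poly alpha (\prod_(i <- l | S i) exp_shift (t i) Q) x =
  \prod_(i <- l | S i) exp_poly alpha Q (x + t i).
Proof.
rewrite /exp_poly rmorph_prod; apply: eq_bigr => i _.
exact: exp_poly_shift.
Qed.

Lemma exp_poly_of_poly (p : {poly R}) :
  exists P, forall x, exp_poly alpha P x = p.[x].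
Proof.
exists (\sum_(i < size p) p`_i *: 'X_ord0 ^+ i) => x.
rewrite /exp_poly rmorph_sum horner_coef; apply: eq_bigr => i _.
by rewrite /= mevalZ rmorphXn /= mevalXU unlift_none.
Qed.

Lemma exp_sum_shift s p c x :
  exp_sum s (fun e => Y e 1 *: (p e \Po ('X + 1%:P)) - c *: p e) x =
  exp_sum s p (x + 1) - c * exp_sum s p x.
Proof.
rewrite /exp_sum mulr_sumr -sumrB; apply: eq_bigr => e _.
rewrite exp_monomialD // hornerD hornerN !hornerZ horner_comp hornerD hornerX.
by rewrite hornerC; ring.
Qed.

Lemma exp_sum_const s p e0 (c : R) x : uniq s -> e0 \in s ->
  p e0 = c%:P -> {in s, forall e, e != e0 -> p e = 0} ->
  exp_sum s p x = c * Y e0 x.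
Proof.
move=> s_uniq e0s pe0 p0; rewrite /exp_sum (bigD1_seq e0) //= pe0 hornerC.
rewrite big_seq_cond big1 ?addr0 // => e /andP[es ne].
by rewrite p0 // horner0 mul0r.
Qed.

(** Transfers [shift_stable_const] from coefficients to functions. [N] will be vanishing at all
    large integers in one use, membership in J in the other. *)
Lemma exp_sum_stable s (N : (R -> R) -> Prop) :
  uniq s ->
  (forall g h, g =1 h -> N g -> N h) ->
  (forall g c, N g -> N (fun x => g (x + 1) - c * g x)) ->
  forall p, N (exp_sum s p) -> (exists2 e, e \in s & p e != 0) ->
  exists e0 c, [/\ e0 \in s, c != 0 & N (fun x => c * Y e0 x)].
Proof.
move=> s_uniq Next Nshift p Np p_neq0.
have [|e _||p' [e0 [c [Np' e0s c0 pe0 p0]]]] := @shift_stable_const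
    R _ s (Y^~ 1) (fun p => N (exp_sum s p)) s_uniq _ _ _ _ Np p_neq0.
- by apply: in2W; apply: exp_monomial1_inj.
- by rewrite gt_eqF ?exp_monomial_gt0.
- by move=> q c Nq; apply: Next (Nshift _ c Nq) => x; rewrite exp_sum_shift.
exists e0, c; split=> //; apply: Next Np' => x.
exact: exp_sum_const.
Qed.

(** For nonzero [P], the reduction would make a nonzero multiple of some alpha^(e x) vanish at large
    integers, whereas these monomials are positive. *)
Lemma exp_poly_eventually0 P (n0 : nat) :
  (forall n, (n0 <= n)%N -> exp_poly alpha P n%:R = 0) -> P = 0.
Proof.
move=> P0; apply/eqP; apply/negPn/negP => /exp_coef_neq0[mon monP coefP].
pose s := undup [seq exp_exponent mon | mon <- msupp P].
have sP : {in msupp P, forall mon, exp_exponent mon \in s}.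
  by move=> ? ?; rewrite mem_undup map_f.
pose N (g : R -> R) := exists n0, forall n, (n0 <= n)%N -> g n%:R = 0.
have [g h gh [k gk]|g c [k gk]|||e0 [c [_ c0 [k Nk]]]] :=
    @exp_sum_stable s N (undup_uniq _) _ _ (exp_coef P).
- by exists k => n /gk; rewrite gh.
- exists k => n kn; rewrite (gk n kn) natr1 gk ?(leqW kn) //; ring.
- by exists n0 => n /P0; rewrite (exp_polyE _ (undup_uniq _) sP).
- by exists (exp_exponent mon); first exact: sP.
have /eqP := Nk k (leqnn k).
by rewrite mulf_eq0 (negPf c0) gt_eqF // exp_monomial_gt0.
Qed.

(** * Sequences eventually in R(x)[alpha^x] *)

(* Membership of the germ at infinity of h in R(x)[alpha^x], denominators being
   cleared. *)
Definition eventually_exp_frac (h : nat -> R) : Prop :=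
  exists (q : {poly R}) (C : {mpoly R[m.+1]}) (N : nat), q != 0 /\
    forall k, (N <= k)%N -> q.[k%:R] * h k = exp_poly alpha C k%:R.
Local Notation EF := eventually_exp_frac.

Lemma eventually_exp_frac_eq g h (N : nat) :
  (forall k, (N <= k)%N -> g k = h k) -> EF g -> EF h.
Proof.
move=> gh [q [C [N' [q0 qg]]]]; exists q, C, (maxn N N'); split=> // k.
by rewrite geq_max => /andP[/gh <- /qg].
Qed.

Lemma eventually_exp_frac0 : EF (fun=> 0).
Proof.
exists 1, 0, 0%N; split; first exact: oner_neq0.
by move=> k _; rewrite mulr0 /exp_poly meval0.
Qed.

Lemma eventually_exp_frac_exp_poly C : EF (fun k => exp_poly alpha C k%:R).
Proof. by exists 1, C, 0%N; split=> [|k _]; rewrite ?oner_neq0 ?hornerC ?mul1r. Qed.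

Lemma eventually_exp_fracMl r g : EF g -> EF (fun k => r.[k%:R] * g k).
Proof.
move=> [q [C [N [q0 qg]]]]; have [r' r'E] := exp_poly_of_poly r.
exists q, (r' * C), N; split=> // k /qg qgk.
by rewrite exp_polyM r'E mulrCA qgk.
Qed.

(** The denominator absorbs [r]; this allows a recurrence to be solved for its top term. *)
Lemma eventually_exp_frac_divl r g :
  r != 0 -> EF (fun k => r.[k%:R] * g k) -> EF g.
Proof.
move=> r0 [q [C [N [q0 qg]]]]; exists (q * r), C, N.
by split=> [|k /qg]; rewrite ?mulf_neq0 // hornerM mulrA.
Qed.

Lemma eventually_exp_fracD g h : EF g -> EF h -> EF (fun k => g k + h k).
Proof.
move=> [q [C [N [q0 qg]]]] [q' [C' [N' [q'0 qh]]]].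
have [p pE] := exp_poly_of_poly q; have [p' p'E] := exp_poly_of_poly q'.
exists (q * q'), (p' * C + p * C'), (maxn N N'); split; first exact: mulf_neq0.
move=> k; rewrite geq_max => /andP[/qg qgk /qh qhk].
by rewrite exp_polyD !exp_polyM pE p'E -qgk -qhk hornerM; ring.
Qed.

Lemma eventually_exp_frac_sum n (g : 'I_n -> nat -> R) :
  (forall i, EF (g i)) -> EF (fun k => \sum_(i < n) g i k).
Proof.
elim: n g => [|n IHn] g EFg.
  apply: (@eventually_exp_frac_eq _ _ 0) eventually_exp_frac0 => k _.
  by rewrite big_ord0.
apply: (@eventually_exp_frac_eq (fun k =>
  \sum_(i < n) g (widen_ord (leqnSn n) i) k + g ord_max k) _ 0) => [k _|].
  by rewrite big_ord_recr.
by apply: eventually_exp_fracD => //; apply: IHn => i.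
Qed.

Lemma eventually_exp_fracS g : EF g -> EF (fun k => g k.+1).
Proof.
move=> [q [C [N [q0 qg]]]]; exists (q \Po ('X + 1%:P)), (exp_shift 1 C), N.
split=> [|k Nk].
  by rewrite -size_poly_gt0 size_comp_poly2 ?size_XaddC // size_poly_gt0.
rewrite exp_poly_shift horner_comp hornerD hornerX hornerC natr1.
by apply: qg; apply: leqW.
Qed.

(** Cross-multiplying f(x + n) = C(x) / (q(x) alpha^(e x)) gives an identity meaningful at every
    real x, zeros of [Q] and [q] included. *)
Lemma holonomic_exp_quotient (f : R -> R) P Q (d : nat) (r : nat -> {poly R})
    (n0 : nat) :
  Q != 0 ->
  (forall x, f x * exp_poly alpha Q x = exp_poly alpha P x) ->
  r d != 0 ->
  (forall n, (n0 <= n)%N -> \sum_(i < d.+1) (r i).[n%:R] * f (n + i)%:R = 0) ->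
  exists (n : nat) (q : {poly R}) e C, q != 0 /\
    forall x, q.[x] * Y e x * exp_poly alpha P (x + n%:R) =
              exp_poly alpha C x * exp_poly alpha Q (x + n%:R).
Proof.
move=> Q0 fQ rd0 rec; pose D := \prod_(i < d) exp_shift i%:R Q.
have shift_neq0 t : exp_shift t Q != 0.
  apply: contraNneq Q0 => Qt0; apply/eqP/(@exp_poly_eventually0 _ 0) => n _.
  rewrite -[n%:R](subrK t) -exp_poly_shift Qt0.
  exact: meval0.
have D0 : D != 0 by apply/prodf_neq0 => i _.
have DE x : exp_poly alpha D x = \prod_(i < d) exp_poly alpha Q (x + i%:R).
  exact: exp_poly_prod_shift.
have DEF n : EF (fun k => exp_poly alpha D k%:R * f (k + n)%:R).
  have [p] := ubnP n; elim: p n => // p IHp n ltnp.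
  have [ltnd|ledn] := ltnP n d.
    (* For n < d, the factor of [D] of index n clears the denominator of f(k + n). *)
    pose E := (\prod_(i < d | i != Ordinal ltnd) exp_shift i%:R Q) *
      exp_shift n%:R P.
    apply: (@eventually_exp_frac_eq (fun k => exp_poly alpha E k%:R) _ 0)
      => [k _|]; last exact: eventually_exp_frac_exp_poly.
    rewrite /E exp_polyM exp_poly_shift -fQ -natrD DE.
    rewrite exp_poly_prod_shift [in RHS](bigD1 (Ordinal ltnd)) //= -natrD.
    by ring.
  (* For n >= d, the recurrence at k + (n - d) has top term f(k + n); induction covers its other
     terms, and [r' d] is divided out. *)
  pose r' i := r i \Po ('X + (n - d)%:R%:P).
  have r'E i k : (r' i).[k%:R] = (r i).[(k + (n - d))%:R].
    by rewrite horner_comp hornerD hornerX hornerC natrD.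
  apply: (@eventually_exp_frac_divl (r' d)).
    by rewrite -size_poly_gt0 size_comp_poly2 ?size_XaddC // size_poly_gt0.
  apply: (@eventually_exp_frac_eq (fun k => \sum_(i < d) (- r' i).[k%:R] *
      (exp_poly alpha D k%:R * f (k + (n - d + i))%:R)) _ n0) => [k n0k|].
    have := rec (k + (n - d))%N (leq_trans n0k (leq_addr _ _)).
    rewrite big_ord_recr /= -r'E -addnA subnK // => /eqP.
    rewrite addrC addr_eq0 => /eqP fkn; rewrite mulrCA fkn -sumrN mulr_sumr.
    by apply: eq_bigr => i _; rewrite hornerN r'E addnA; ring.
  apply: eventually_exp_frac_sum => i.
  apply/eventually_exp_fracMl/IHp; rewrite -ltnS (leq_trans _ ltnp) // ltnS.
  by rewrite -[X in (_ < X)%N](subnK ledn) ltn_add2l.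
(* [N] is J, with arbitrary functions in place of exponential polynomials. *)
pose N (g : R -> R) := exists n1, forall n, (n1 <= n)%N ->
  EF (fun k => g k%:R * f (k + n)%:R).
have [mon monD coefD] := exp_coef_neq0 D0.
pose s := undup [seq exp_exponent mon | mon <- msupp D].
have sD : {in msupp D, forall mon, exp_exponent mon \in s}.
  by move=> ? ?; rewrite mem_undup map_f.
have [g h gh [k gk]|g c [k gk]|||e [c [es c0 [n Nn]]]] :=
    @exp_sum_stable s N (undup_uniq _) _ _ (exp_coef D).
- exists k => n /gk; apply: (@eventually_exp_frac_eq _ _ 0) => j _.
  by rewrite gh.
(* g(j + 1) f(j + 1 + n) is the sequence of index n taken at j + 1, and g(j) f(j + n + 1) that of
   index n + 1 taken at j; hence the threshold [k.+1]. *)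
- exists k.+1 => -[//|n] kn.
  apply: (@eventually_exp_frac_eq (fun j => g j.+1%:R * f (j.+1 + n)%:R +
      (- c)%:P.[j%:R] * (g j%:R * f (j + n.+1)%:R)) _ 0) => [j _|].
    by rewrite hornerC natr1 addSnnS; ring.
  apply: eventually_exp_fracD.
    exact: (@eventually_exp_fracS (fun j => g j%:R * f (j + n)%:R) (gk _ kn)).
  by apply: eventually_exp_fracMl; apply: gk; apply: ltnW.
- exists 0%N => n _; apply: (@eventually_exp_frac_eq _ _ 0) (DEF n) => k _.
  by rewrite (exp_polyE _ (undup_uniq _) sD).
- by exists (exp_exponent mon); first exact: sD.
have [q [C [k0 [q0 qC]]]] := Nn n (leqnn n).
have [mon' mon'D eE] : exists2 mon', mon' \in msupp D & e = exp_exponent mon'.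
  by apply/mapP; rewrite mem_undup in es.
have [M ME] := exp_poly_of_poly (c *: q).
(* The monomial [mon'] brings x^(mon' ord0) along with alpha^(e x), so both witnesses carry this
   power of x. *)
exists n, (c *: q * 'X^(mon' ord0)), e, (C * 'X_ord0 ^+ mon' ord0).
split.
  by rewrite mulf_neq0 ?scaler_eq0 ?negb_or ?c0 // -size_poly_gt0 size_polyXn.
have XE x j : exp_poly alpha ('X_ord0 ^+ j) x = x ^+ j.
  by rewrite /exp_poly rmorphXn /= mevalXU unlift_none.
(* [Z] is the difference of the two sides: it vanishes at integers k >= k0 because f Q = P, hence
   everywhere. *)
pose Z := M * 'X_[mon'] * exp_shift n%:R P -
  C * 'X_ord0 ^+ mon' ord0 * exp_shift n%:R Q.
have ZE x : exp_poly alpha Z x =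
  (c *: q * 'X^(mon' ord0)).[x] * Y e x * exp_poly alpha P (x + n%:R) -
  exp_poly alpha (C * 'X_ord0 ^+ mon' ord0) x * exp_poly alpha Q (x + n%:R).
  rewrite exp_polyB !exp_polyM !exp_poly_shift exp_poly_mon ME XE hornerM.
  by rewrite hornerXn eE; ring.
have Z0 : Z = 0.
  apply: (@exp_poly_eventually0 _ k0) => k /qC qCk.
  rewrite ZE exp_polyM XE hornerM hornerXn hornerZ -fQ -qCk natrD.
  by ring.
move=> x; apply/eqP; rewrite -subr_eq0 -ZE Z0.
by rewrite /exp_poly meval0.
Qed.

End ExpPolynomials.

(** * From complex to real recurrences *)

(** As [f] is real, [proj] acts on the coefficients alone. Cutting the order at the last nonzero
    projected coefficient makes the leading one nonzero. *)
Lemma real_recurrence_of_projection (R : realType)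
    (proj : {additive R[i] -> R}) (f : nat -> R) (d : nat)
    (p : 'I_d.+1 -> {poly R[i]}) (n0 : nat) :
  (forall z x, proj (z * x%:C%C) = proj z * x) ->
  (exists i, map_poly proj (p i) != 0) ->
  (forall n, (n0 <= n)%N ->
     \sum_(i < d.+1) (p i).[n%:R] * ((f (n + i)%N)%:C)%C = 0) ->
  exists (d' : nat) (r : nat -> {poly R}), r d' != 0 /\
    forall n, (n0 <= n)%N -> \sum_(i < d'.+1) (r i).[n%:R] * f (n + i)%N = 0.
Proof.
move=> projM [i0 pi0] rec.
have projE (q : {poly R[i]}) n : proj q.[n%:R] = (map_poly proj q).[n%:R].
  rewrite horner_coef horner_poly raddf_sum; apply: eq_bigr => j _ /=.
  by rewrite -projM rmorphXn /= rmorph_nat.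
pose r (i : nat) := map_poly proj (p (inord i)).
case: (@arg_maxnP _ i0 (fun i => map_poly proj (p i) != 0) (@nat_of_ord _) pi0).
move=> j pj jmax; exists j, r; split=> [|n /rec]; first by rewrite /r inord_val.
move=> /(congr1 proj); rewrite raddf0 raddf_sum => recn; rewrite -[RHS]recn.
rewrite (big_ord_widen d.+1 (fun i => (r i).[n%:R] * f (n + i)%N)) //.
rewrite big_mkcond; apply: eq_bigr => i _ /=.
rewrite projM projE /r inord_val; case: ltnP => // lti.
have [->|/jmax/=] := eqVneq (map_poly proj (p i)) 0; first by rewrite horner0 mul0r.
by rewrite /geq /= leqNgt lti.
Qed.

(** A nonzero complex polynomial has a nonzero real or imaginary part; that part serves as the
    projection. *)
Lemma holonomic_real (R : realType) (f : nat -> R) :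
  holonomic (fun n => ((f n)%:C)%C) ->
  exists (d : nat) (r : nat -> {poly R}) (n0 : nat), r d != 0 /\
    forall n, (n0 <= n)%N -> \sum_(i < d.+1) (r i).[n%:R] * f (n + i)%N = 0.
Proof.
move=> [d [p [[i pi] [n0 rec]]]].
have ReM (z : R[i]) (x : R) : complex.Re (z * x%:C%C) = complex.Re z * x.
  by case: z => a b /=; rewrite mulr0 subr0.
have ImM (z : R[i]) (x : R) : complex.Im (z * x%:C%C) = complex.Im z * x.
  by case: z => a b /=; rewrite mulr0 add0r.
have [Re0|Re_neq0] := eqVneq (map_poly (@complex.Re R) (p i)) 0; last first.
  have [|d' [r [r0 rrec]]] := real_recurrence_of_projection ReM _ rec.
    by exists i.
  by exists d', r, n0.
have [|d' [r [r0 rrec]]] := real_recurrence_of_projection ImM _ rec.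
  exists i; apply: contraNneq pi => Im0; apply/eqP/polyP => j.
  have /polyP/(_ j) := Re0; have /polyP/(_ j) := Im0.
  rewrite !coef_map_id0 ?coef0 //.
  by case: (p i)`_j => a b /= -> ->.
by exists d', r, n0.
Qed.

Theorem theorem10 (R : realType) (m : nat) (alpha : 'I_m -> R)
    (alpha_gt0 : forall i, 0 < alpha i)
    (ln_alpha_indep : lin_indep_rat (fun i => ln (alpha i)))
    (f : R -> R) (P Q : {mpoly R[m.+1]})
    (Q_neq0 : exists x, exp_poly alpha Q x != 0)
    (fE : forall x, exp_poly alpha Q x != 0 ->
            f x = exp_poly alpha P x / exp_poly alpha Q x)
    (f_holonomic : holonomic (fun n : nat => ((f n%:R)%:C)%C)) :
  exists (s : seq {ffun 'I_m -> int}) (p q : {ffun 'I_m -> int} -> {poly R}),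
    (forall e, e \in s -> q e != 0) /\
    forall x, exp_poly alpha Q x != 0 ->
      (forall e, e \in s -> (q e).[x] != 0) ->
      f x = exp_laurent alpha s p q x.
Proof.
have [d [r [n0 [rd0 rec]]]] := holonomic_real f_holonomic.
have Q0 : Q * Q != 0.
  case: Q_neq0 => x Qx; rewrite mulf_eq0 orbb.
  by apply: contraNneq Qx => ->; rewrite /exp_poly meval0.
(* f is unconstrained at the zeros of Q, but f Q^2 = P Q holds everywhere. *)
have fQ x : f x * exp_poly alpha (Q * Q) x = exp_poly alpha (P * Q) x.
  rewrite !exp_polyM; have [->|Qx] := eqVneq (exp_poly alpha Q x) 0.
    by rewrite !mulr0.
  by rewrite fE // mulrA divfK.
have [n [q [e0 [C [q0 qE]]]]] :=
  holonomic_exp_quotient alpha_gt0 ln_alpha_indep Q0 fQ rd0 rec.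
(* [C'] and [q'] move the identity from f(x + n) to f(x); [q'] absorbs the constant alpha^(-n
   e0). *)
pose C' := exp_shift alpha (- n%:R) C.
(* Including [e0] keeps the list nonempty, so that the hypothesis on denominators yields q'(x) != 0
   even when [C'] is zero. *)
pose s := undup (e0 :: [seq exp_exponent mon | mon <- msupp C']).
have sC : {in msupp C', forall mon, exp_exponent mon \in s}.
  by move=> mon monC; rewrite mem_undup inE map_f ?orbT.
pose q' := exp_monomial alpha e0 (- n%:R) *: (q \Po ('X + (- n%:R)%:P)).
have Y_gt0 := exp_monomial_gt0 alpha_gt0.
(* Dividing [C'] by q' alpha^(e0 x) translates the exponents by -e0 and gives all terms the
   denominator [q']. *)
exists [seq e - e0 | e <- s], (fun e => exp_coef C' (e + e0)), (fun=> q'); split.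
  move=> _ _; rewrite scaler_eq0 negb_or gt_eqF //=.
  by rewrite -size_poly_gt0 size_comp_poly2 ?size_XaddC // size_poly_gt0.
move=> x Qx q'x.
have {}q'x : q'.[x] != 0.
  by apply: (q'x (e0 - e0)); apply/mapP; exists e0; rewrite ?mem_undup ?mem_head.
(* This is the identity at x - n, after cancelling the nonzero Q(x)^2. *)
have fx : q'.[x] * exp_monomial alpha e0 x * f x = exp_poly alpha C' x.
  have := qE (x - n%:R); rewrite subrK -fQ mulrA exp_polyM.
  move=> /(mulIf (mulf_neq0 Qx Qx)).
  rewrite exp_poly_shift // => <-.
  rewrite exp_monomialD // hornerZ horner_comp hornerD hornerX hornerC.
  by ring.
have Yx : exp_monomial alpha e0 x != 0 by rewrite gt_eqF.
apply: (mulfI (mulf_neq0 q'x Yx)); rewrite fx.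
rewrite (exp_polyE _ _ (undup_uniq _) sC) /exp_sum /exp_laurent big_map mulr_sumr.
apply: eq_bigr => e _; rewrite subrK -/(exp_monomial alpha (e - e0) x).
rewrite exp_monomialB //.
by field; rewrite q'x Yx.
Qed.
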